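(* Let $\mathcal G$ be a finite weighted multigraph satisfying: (A.1) the random walk on $\mathcal G$ is irreducible; (A.2) $\mathcal G$ has at least two distinct oriented cycles which are not each other's inverse; (A.3) all oriented edges of $\mathcal G$ have positive weight; (A.4) every oriented edge of $\mathcal G$ lies on an oriented cycle. Let $(\mathcal X_t)_{t\ge0}$ be the random walk on the universal cover $(\mathcal T_{\mathcal G},\circ)$ started at the root, and $\xi$ its ray to infinity. There exist constants $C_1,C_2>0$ depending only on $\mathcal G$ such that for all integers $R,t\ge1$, $$\mathbb P\big(\xi\cap B(\mathcal X_t,R)=\emptyset\big)\le C_1\exp(-C_2R),$$ where $B(y,R)$ is the set of vertices $y'$ such that there is an oriented path of length at most $R$ from $y$ to $y'$.
   Context: **Weighted multigraph and random walk.** $\mathcal G$ is a finite multigraph (multiple edges and multiple loops allowed) with vertex set $V$. Every edge (loops included) gives rise to two opposite oriented edges; $\vec E$ is the set of oriented edges and $\vec e^{\,-1}$ is the opposite of $\vec e$. Each $\vec e\in\vec E$ has a weight $w(\vec e)\ge 0$ such that every edge has at least one orientation with positive weight, and for each $u\in V$ the weights of the oriented edges going out of $u$ sum to $1$. The random walk (RW) on such a weighted graph (finite or infinite) is the Markov chain on its vertices with transition matrix $P(u,v)=\frac12\mathbf 1_{\{u=v\}}+\frac12\sum_{\vec e:u\to v}w(\vec e)$, the sum being over oriented edges from $u$ to $v$. **Oriented cycles.** An oriented cycle of length $m\ge1$ is a cyclic order $C=(\vec e_1,\dots,\vec e_m)$ of $m$ (distinct) oriented edges with positive weight such that, for all $i$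 mod $m$, the end vertex of $\vec e_i$ is the initial vertex of $\vec e_{i+1}$ and $\vec e_i\ne\vec e_{i+1}^{\,-1}$. Its inverse is $C^{-1}=(\vec e_m^{\,-1},\dots,\vec e_1^{\,-1})$. **Universal cover.** Fix $v_*\in V$. The universal cover $(\mathcal T_{\mathcal G},\circ)$ is the rooted tree whose vertices are the finite non-backtracking paths in $\mathcal G$ starting at $v_*$ (paths $(\vec e_1,\dots,\vec e_m)$ with $\vec e_{i+1}\neq \vec e_i^{\,-1}$), the root $\circ$ being the empty path, with an edge between each path $p$ and each one-edge non-backtracking extension $p\vec e$; the oriented edge $(p,p\vec e)$ has label $\vec e$, its opposite has label $\vec e^{\,-1}$, and oriented edges carry the weights of their labels. $V_x$ is the set of vertices $y$ such that $x$ lies on the tree path from $\circ$ to $y$. Under the hypotheses the RW on $(\mathcal T_{\mathcal G},\circ)$ is transient. The ray to infinity of the RW started at $\circ$ is $\xi=\{x:\exists s\ge0,\ \mathcal X_s=x \text{ and } \mathcal X_t\in V_x\ \forall t\ge s\}$. Under (A.3), $B(y,R)$ is the usual ball of radius $R$ for the graph distance. *)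

(* Defs.v *)
From HB Require Import structures.
From mathcomp Require Import all_boot all_order all_algebra.
From mathcomp Require Import all_classical all_reals all_analysis.
Set Implicit Arguments.
Unset Strict Implicit.
Unset Printing Implicit Defensive.
Import Order.TTheory GRing.Theory Num.Theory.
Local Open Scope classical_set_scope.
Local Open Scope ring_scope.

(* Finite weighted multigraph, in terms of its oriented edges: an unoriented
   edge is a pair [{e, einv e}]. As [einv] has no fixed point, a loop gives rise
   to two oriented edges as well. *)
Record wmultigraph (R : realType) := WMultigraph {
  vertex : finType;
  oedge : finType;
  src : oedge -> vertex;
  tgt : oedge -> vertex;
  einv : oedge -> oedge;
  weight : oedge -> R;
  einvK : involutive einv;
  einv_neq : forall e, einv e != e;
  src_einv : forall e, src (einv e) = tgt e;
  weight_ge0 : forall e, 0 <= weight e;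
  weight_gt0_or : forall e, (0 < weight e) || (0 < weight (einv e));
  weight_out : forall u, \sum_(e | src e == u) weight e = 1
}.

(* Transition probabilities of the lazy walk on a weighted graph with vertex
   type [T], whose oriented edges from [u] to [v] are given by their labels:
   those [e : E] such that [arrow u e v]. *)
Definition rw_trans (R : realType) (T : eqType) (E : finType) (w : E -> R)
    (arrow : T -> E -> T -> bool) (u v : T) : R :=
  2^-1 * (u == v)%:R + 2^-1 * \sum_(e | arrow u e v) w e.

Section Graph.
Context {R : realType}.
Variable G : wmultigraph R.
Implicit Types (u v : vertex G) (e f : oedge G) (c : seq (oedge G)).

Definition graph_arrow u e v : bool := (src e == u) && (tgt e == v).

Definition graph_trans u v : R := rw_trans (@weight R G) graph_arrow u v.

Fixpoint graph_ntrans (n : nat) u v : R :=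
  if n is m.+1 then \sum_z graph_trans u z * graph_ntrans m z v
  else (u == v)%:R.

Definition irreducible_rw : Prop :=
  forall u v, exists n, 0 < graph_ntrans n u v.

Definition nbstep e f : bool := (tgt e == src f) && (e != einv f).

(* A sequence represents an oriented cycle up to rotation, see [same_cycle]. *)
Definition oriented_cycle c : bool :=
  [&& c != [::], uniq c, all (fun e => 0 < weight e) c & cycle nbstep c].

Definition cycle_inv c : seq (oedge G) := rev (map (@einv R G) c).

Definition same_cycle c1 c2 : Prop := exists i, c2 = rot i c1.

Definition two_cycles : Prop :=
  exists c1 c2, [/\ oriented_cycle c1, oriented_cycle c2,
    ~ same_cycle c1 c2 & ~ same_cycle (cycle_inv c1) c2].

Definition positive_weights : Prop := forall e, 0 < weight e.

Definition edges_on_cycles : Prop :=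
  forall e, exists2 c, oriented_cycle c & e \in c.

Definition nbpath v (p : seq (oedge G)) : bool :=
  if p is e :: p' then (src e == v) && path nbstep e p' else true.

End Graph.

(* Vertices of the universal cover based at [v]. *)
Definition ucover (R : realType) (G : wmultigraph R) (v : vertex G) : Type :=
  {p : seq (oedge G) | nbpath v p}.

Section Cover.
Context {R : realType} {G : wmultigraph R} {v : vertex G}.
Implicit Types x y : ucover v.

Definition cover_root : ucover v := exist (fun p => nbpath v p) [::] erefl.

(* There is an oriented edge of the cover from [x] to [y] with label [e]: either
   [y] extends [x] by [e], or [x] extends [y] by the opposite of [e]. There is
   at most one oriented edge from [x] to [y], hence it is identified by [e]. *)
Definition cover_arrow x (e : oedge G) y : bool :=
  (val y == rcons (val x) e) || (val x == rcons (val y) (einv e)).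

Definition cover_trans x y : R := rw_trans (@weight R G) cover_arrow x y.

Definition cover_adj x y : bool := [exists e, cover_arrow x e y].

Definition pos_cover_adj x y : bool :=
  [exists e, cover_arrow x e y && (0 < weight e)].

(* [subtree x] is the set $V_x$; the tree path from the root to [y] is the
   simple one. *)
Definition subtree x : set (ucover v) :=
  [set y | exists s : seq (ucover v),
    [/\ path cover_adj cover_root s, uniq (cover_root :: s),
        last cover_root s = y & x \in cover_root :: s]].

(* Oriented paths use oriented edges of positive weight. *)
Definition cover_ball x (r : nat) : set (ucover v) :=
  [set y | exists s : seq (ucover v),
    [/\ path pos_cover_adj x s, last x s = y & (size s <= r)%N]].

Definition ray (X : nat -> ucover v) : set (ucover v) :=
  [set x | exists s, X s = x /\ forall t, (s <= t)%N -> subtree x (X t)].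

End Cover.

(* [X] is a Markov chain on the countable set [S], started at [x0] and with
   transition matrix [p]. The last condition is the Markov property
   $P(X_{n+1} = y | X_0 = x_0, ..., X_n = x_n) = p(x_n, y)$, multiplied by the
   probability of the conditioning event. *)
Definition markov_chain_from (R : realType) (d : measure_display)
    (T : measurableType d) (P : probability T R) (S : countType) (x0 : S)
    (p : S -> S -> R) (X : nat -> T -> S) : Prop :=
  [/\ forall n x, measurable [set w | X n w = x],
      P [set w | X 0%N w = x0] = 1%E &
      forall (n : nat) (x : nat -> S) (y : S),
        P [set w | (forall i, (i <= n)%N -> X i w = x i) /\ X n.+1 w = y] =
        (P [set w | forall i, (i <= n)%N -> X i w = x i] * (p (x n) y)%:E)%E].

(* Main.v *)
Require Import Defs.
From HB Require Import structures.
From mathcomp Require Import all_boot all_order all_algebra.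
From mathcomp Require Import all_classical all_reals all_analysis.
From mathcomp Require Import ring lra zify.
Set Implicit Arguments.
Unset Strict Implicit.
Unset Printing Implicit Defensive.
Import Order.TTheory GRing.Theory Num.Theory.
Local Open Scope classical_set_scope.
Local Open Scope ring_scope.

(* Superharmonic functions on the cover. Let [phi] be a weight in (0, k], k < 1,
   on oriented edges such that, for each edge e,
     w(e^-1) + phi(e) sum_(f after e) w(f) phi(f) <= phi(e),
   the sum being over non-backtracking steps. Then the product of [phi] along the
   path from y down to z is superharmonic in z, equal to 1 off the subtree of y,
   and thus bounds the probability of ever leaving this subtree. If the ray
   avoids the ball of radius R around X_t, then after time t the walk leaves the
   subtree of the R-th ancestor of X_t, and this has probability at most k^R.

   With phi = 1 - eps y / w(e^-1) and a(e) = w(e) / w(e^-1), one needs y > 0 with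
   y(e) < sum_(f after e) a(f) y(f), i.e. spectral radius > 1 for this matrix. A
   closed non-backtracking walk and its reversal have inverse a-weights, so this
   follows from the strong connectivity of the non-backtracking steps and the
   existence of an edge with two successors. *)

(** * Connectivity of the non-backtracking steps *)

Section NonBacktracking.
Context {R : realType}.
Variable G : wmultigraph R.
Implicit Types (u v : vertex G) (e f g : oedge G) (c : seq (oedge G)).

Lemma einv_inj : injective (@einv _ G).
Proof. exact: inv_inj (@einvK _ G). Qed.

Lemma tgt_einv e : tgt (einv e) = src e.
Proof. by rewrite -src_einv einvK. Qed.

Lemma nbstep_einv e f : nbstep (einv f) (einv e) = nbstep e f.
Proof.
by rewrite /nbstep einvK tgt_einv src_einv eq_sym [einv f == e]eq_sym.
Qed.

Lemma nbstepP e f : tgt e = src f -> e != einv f -> nbstep e f.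
Proof. by rewrite /nbstep => -> ->; rewrite eqxx. Qed.

(** At a fork after [g], a walk may come back along one branch and leave by the other; this is how
    walks change direction below. *)
Lemma nbstep_turn g e f : nbstep g e -> nbstep g f -> e != f ->
  nbstep (einv e) f.
Proof.
move=> /andP[/eqP ge _] /andP[/eqP gf _] ef; apply: nbstepP.
  by rewrite tgt_einv -ge.
by rewrite (inj_eq einv_inj).
Qed.

Lemma connect_einv e f :
  connect (@nbstep _ G) (einv f) (einv e) = connect (@nbstep _ G) e f.
Proof.
suff H a b : connect (@nbstep _ G) a b ->
    connect (@nbstep _ G) (einv b) (einv a).
  by apply/idP/idP => /H; rewrite ?einvK.
move=> /connectP[p]; elim: p a => [|x p IHp] a /=; first by move=> _ ->.
move=> /andP[ax xp] bE; apply: (connect_trans (IHp _ xp bE)).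
by apply: connect1; rewrite nbstep_einv.
Qed.

Lemma mem_cycle_inv c e : (e \in cycle_inv c) = (einv e \in c).
Proof.
by rewrite mem_rev -[in LHS](einvK e) mem_map //; exact: einv_inj.
Qed.

Lemma oriented_cycle_inv (A3 : positive_weights G) c :
  oriented_cycle c -> oriented_cycle (cycle_inv c).
Proof.
case/and4P => c0 uc _ cc; apply/and4P; split.
- case: c c0 {uc cc} => // e c _.
  by rewrite /cycle_inv /= rev_cons -size_eq0 size_rcons.
- by rewrite rev_uniq map_inj_uniq //; exact: einv_inj.
- by apply/allP => e _; exact: A3.
- rewrite rev_cycle cycle_map (eq_cycle (e' := @nbstep _ G)) // => e f /=.
  exact: nbstep_einv.
Qed.

(* If the two cycles took the same step at each of their common edges, then the
   edges before [g] would agree as well. *)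
Lemma cycle_diverge c1 c2 g e1 e2 :
  uniq c1 -> uniq c2 -> e1 \in c1 -> e2 \in c2 -> next c1 e1 = g ->
  next c2 e2 = g -> e1 != e2 ->
  exists h, [/\ h \in c1, h \in c2 & next c1 h != next c2 h].
Proof.
move=> u1 u2 e1c e2c n1 n2 e12; apply: contrapT => nex.
have same h : h \in c1 -> h \in c2 -> next c1 h = next c2 h.
  move=> h1 h2; apply/eqP; apply: contrapT => /negP ne; apply: nex.
  by exists h.
have gc1 : g \in c1 by rewrite -n1 mem_next.
have gc2 : g \in c2 by rewrite -n2 mem_next.
have sub h : h \in c1 -> h \in c2.
  rewrite -(fconnect_cycle (cycle_next u1) gc1) => /iter_findex <-.
  elim: (findex _ _ _) => //= n IHn; rewrite same ?mem_next //.
  by elim: n {IHn} => //= n IHn; rewrite mem_next.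
move/eqP: e12; apply; rewrite -(prev_next u2 e2) n2 -n1 same ?prev_next //.
exact: sub.
Qed.

(** It suffices to undo one step from [e] to [f]: go around a cycle through [f] up to [f0], step
    over to [e'], and follow a cycle through [e] back to [e]. This fails only if [f0] is the inverse
    of [e']. *)
Lemma nbstep_connect_sym (A3 : positive_weights G) (A4 : edges_on_cycles G) :
  connect_sym (@nbstep _ G).
Proof.
suff H e f : nbstep e f -> connect (@nbstep _ G) f e.
  move=> e f; apply/idP/idP => /connectP[p];
    (elim: p e f => [|x p IHp] e f /=; first by move=> _ ->);
    by move=> /andP[ex xp] fE; apply: (connect_trans (IHp _ _ xp fE)); exact: H.
move=> ef; have [c oc ec] := A4 e; have [d od fd] := A4 f.
have /and4P[_ uc _ cc] := oc; have /and4P[_ ud _ cd] := od.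
have [/eqP te nef] := andP ef.
have c_conn := connect_cycle cc; have d_conn := connect_cycle cd.
set e' := next c e; have ec' : e' \in c by rewrite mem_next.
have ee' : nbstep e e' := next_cycle cc ec.
set f0 := prev d f; have fd0 : f0 \in d by rewrite mem_prev.
have f0f : nbstep f0 f := prev_cycle cd fd.
have [fe'|fe'] := eqVneq f e'.
  by rewrite fe'; exact: c_conn.
have [f0E|f0e] := eqVneq f0 (einv e'); last first.
  apply: (connect_trans (d_conn _ _ fd fd0)).
  apply: (connect_trans _ (c_conn _ _ ec' ec)); apply: connect1.
  apply: nbstepP => //; move/andP: f0f => [/eqP -> _].
  by move/andP: ee' => [/eqP <- _].
(* Now [c] and the inverse [d'] of [d] merge at [e'], hence diverge at some [g]. From [einv e']
   follow [c] backwards to that fork, turn into [d'], and return along it to [e']. *)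
pose d' := cycle_inv d; have od' := oriented_cycle_inv A3 od.
have /and4P[_ ud' _ cd'] := od'.
have fd' : einv f \in d' by rewrite mem_cycle_inv einvK.
have nd' : next d' (einv f) = e'.
  rewrite next_rev ?(map_inj_uniq einv_inj) // (prev_map einv_inj) //.
  by rewrite -/f0 f0E einvK.
have [g [gc gd ng]] := cycle_diverge uc ud' ec fd' (erefl _) nd' nef.
have turn : nbstep (einv (next c g)) (next d' g).
  by apply: nbstep_turn ng; exact: next_cycle.
apply: (connect_trans (d_conn _ _ fd fd0)); rewrite f0E.
have /connect_trans-> // : connect (@nbstep _ G) (einv e') (einv (next c g)).
  by rewrite connect_einv; apply: c_conn; rewrite ?mem_next.
apply: (connect_trans (connect1 turn)).
have /connect_trans-> // : connect (@nbstep _ G) (next d' g) e'.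
  by apply: (connect_cycle cd'); rewrite -?nd' ?mem_next.
exact: c_conn.
Qed.

(** Irreducibility as an induction principle: a transition of positive probability stays put or
    follows an edge. *)
Lemma graph_ntrans_edge (A1 : irreducible_rw G) (Q : vertex G -> Prop) v :
  Q v -> (forall e, Q (tgt e) -> Q (src e)) -> forall u, Q u.
Proof.
move=> Qv step u; have [n] := A1 u v.
elim: n u => [|n IHn] u /=.
  by case: eqP => [->|_] //; rewrite ltxx.
move=> lt; have [z zlt] : exists z, 0 < graph_trans u z * graph_ntrans n z v.
  apply: contrapT => nex; move: lt; rewrite ltNge => /negP; apply.
  by apply: sumr_le0 => z _; rewrite leNgt; apply/negP => ?; apply: nex; exists z.
have w0 (P : pred (oedge G)) : 0 <= \sum_(e | P e) weight e.
  by apply: sumr_ge0 => e _; exact: weight_ge0.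
have t0 : 0 <= graph_trans u z.
  by rewrite addr_ge0 // mulr_ge0 // ?invr_ge0 // ler0n.
have [tp np] : 0 < graph_trans u z /\ 0 < graph_ntrans n z v.
  move: t0; rewrite le_eqVlt => /orP[/eqP t0|tp].
    by move: zlt; rewrite -t0 mul0r ltxx.
  by split=> //; rewrite -(pmulr_rgt0 _ tp).
have Qz := IHn _ np; move: tp; rewrite /graph_trans /rw_trans.
have [->//|uz] := eqVneq u z; rewrite mulr0 add0r => sp.
have [e /andP[/eqP <- /eqP tz]|none] := pickP (graph_arrow u ^~ z).
  by apply: step; rewrite tz.
by move: sp; rewrite big_pred0 ?mulr0 ?ltxx // => e; have := none e.
Qed.

(** If [a] and [b] are distinct edges out of one vertex, [einv a] steps to [b], so reaching [f] up
    to inversion depends only on the initial vertex. Inverting an edge passes to its other end, and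
    irreducibility concludes. *)
Lemma connect_up_to_einv (A1 : irreducible_rw G) (A3 : positive_weights G)
    (A4 : edges_on_cycles G) e f :
  connect (@nbstep _ G) e f || connect (@nbstep _ G) (einv e) f.
Proof.
have sym := nbstep_connect_sym A3 A4.
pose Q u := forall e, src e = u ->
  connect (@nbstep _ G) e f || connect (@nbstep _ G) (einv e) f.
suff : Q (src e) by exact.
have same_src a b : src a = src b ->
    connect (@nbstep _ G) a f || connect (@nbstep _ G) (einv a) f ->
    connect (@nbstep _ G) b f || connect (@nbstep _ G) (einv b) f.
  move=> ab; have [->//|neab] := eqVneq b a.
  have ab' : nbstep (einv a) b.
    by apply: nbstepP; rewrite ?tgt_einv // (inj_eq einv_inj) eq_sym.
  move=> /orP[af|af].
    apply/orP; right; apply: connect_trans af.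
    by rewrite connect1 // -[a]einvK nbstep_einv.
  by apply/orP; left; apply: connect_trans af; rewrite sym connect1.
apply: (graph_ntrans_edge A1 (v := src f)).
  by move=> b bf; apply: (same_src f) => //; rewrite connect0.
move=> a Qa b ba; apply: (same_src a) => //.
by have := Qa (einv a); rewrite src_einv einvK orbC; exact.
Qed.

(** Otherwise the steps are given by a function and the oriented cycles are its orbits; [c1] or its
    inverse then shares its orbit with [c2], contrary to A2. *)
Lemma nbstep_diverge (A1 : irreducible_rw G) (A2 : two_cycles G)
    (A3 : positive_weights G) (A4 : edges_on_cycles G) :
  exists g g1 g2 : oedge G, [/\ nbstep g g1, nbstep g g2 & g1 != g2].
Proof.
have [c1 [c2 [oc1 oc2 nc nci]]] := A2.
apply: contrapT => nex.
have uni g g1 g2 : nbstep g g1 -> nbstep g g2 -> g1 = g2.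
  move=> n1 n2; apply/eqP; apply: contrapT => /negP ne; apply: nex.
  by exists g, g1, g2.
(* A4 puts [e] on a cycle, so [s e] is a true successor and the default [e] never arises. *)
pose s (e : oedge G) := odflt e [pick f | nbstep e f].
have sE e f : nbstep e f = (s e == f).
  rewrite /s; case: pickP => [h eh|none] /=.
    by apply/idP/eqP => [/(uni _ _ _ eh)//|<-].
  have [c /and4P[_ _ _ cc] ec] := A4 e.
  by have := next_cycle cc ec; rewrite none.
have fc c : oriented_cycle c -> fcycle s c.
  by case/and4P => _ _ _; rewrite (eq_cycle sE).
have [f fc2] : exists f, f \in c2.
  by case/and4P: oc2; case: (c2) => // f c _ _ _ _; exists f; rewrite inE eqxx.
have key c e : oriented_cycle c -> e \in c -> connect (@nbstep _ G) e f ->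
    same_cycle c c2.
  move=> oc ec; rewrite (eq_connect sE) (fconnect_cycle (fc _ oc) ec) => fcc.
  have /and4P[_ uc _ _] := oc; have /and4P[_ u2 _ _] := oc2.
  have [i Ei] := orbit_rot_cycle (fc _ oc) uc fcc.
  have := orbitE (fc _ oc2) u2 fc2; rewrite Ei => /(congr1 (rotr (index f c2))).
  by rewrite rotK => <-; rewrite /rotr rot_rot_add; eexists.
have [e ec1] : exists e, e \in c1.
  by case/and4P: oc1; case: (c1) => // e c _ _ _ _; exists e; rewrite inE eqxx.
have /orP[ef|ef] := connect_up_to_einv A1 A3 A4 e f.
  exact: nc (key _ _ oc1 ec1 ef).
apply: nci (key _ _ (oriented_cycle_inv A3 oc1) _ ef).
by rewrite mem_cycle_inv einvK.
Qed.

(** A fork connects [g] to its own inverse: go out along one branch and, by symmetry, come back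
    along the other. This removes the choice left by [connect_up_to_einv]. *)
Lemma nbstep_connected (A1 : irreducible_rw G) (A2 : two_cycles G)
    (A3 : positive_weights G) (A4 : edges_on_cycles G) e f :
  connect (@nbstep _ G) e f.
Proof.
have sym := nbstep_connect_sym A3 A4.
have [g [g1 [g2 [gg1 gg2 g12]]]] := nbstep_diverge A1 A2 A3 A4.
have gN : connect (@nbstep _ G) g (einv g).
  apply: (connect_trans (connect1 gg2)); rewrite sym.
  have /connect_trans-> // : connect (@nbstep _ G) (einv g) (einv g1).
    by rewrite connect_einv sym connect1.
  by rewrite connect1 // (nbstep_turn gg1 gg2).
have toN a b : connect (@nbstep _ G) (einv a) b ->
    connect (@nbstep _ G) a (einv b).
  by rewrite -(connect_einv _ (einv b)) einvK sym.
have tog a : connect (@nbstep _ G) a g.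
  have /orP[//|/toN] := connect_up_to_einv A1 A3 A4 a g.
  by move=> /connect_trans-> //; rewrite sym.
by apply: (connect_trans (tog e)); rewrite sym.
Qed.

End NonBacktracking.

(** * Weighted walks for a relation on a finite type *)

Section WalkWeight.
Context {R : realType} {E : finType}.
Variables (r : rel E) (a : E -> R).
Hypothesis a_gt0 : forall e, 0 < a e.

(** The entry at ([e], [g]) of the [n]-th power of the matrix whose entry at ([e], [f]) is [a f]
    when [r e f] and 0 otherwise. *)
Fixpoint walk_weight (g : E) (n : nat) (e : E) : R :=
  if n is m.+1 then \sum_(f | r e f) a f * walk_weight g m f
  else (e == g)%:R.

Lemma walk_weight_ge0 g n e : 0 <= walk_weight g n e.
Proof.
elim: n e => [|n IHn] e /=; first exact: ler0n.
by apply: sumr_ge0 => f _; rewrite mulr_ge0 // ltW.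
Qed.

Lemma walk_weight_path g n e s : path r e s ->
  (\prod_(f <- s) a f) * walk_weight g n (last e s)
    <= walk_weight g (size s + n) e.
Proof.
elim: s e => [|f s IHs] e /=; first by rewrite big_nil mul1r.
move=> /andP[ef fs]; rewrite big_cons -mulrA (bigD1 f) //=.
apply: (@le_trans _ _ (a f * walk_weight g (size s + n) f)).
  by rewrite ler_pM2l // IHs.
by rewrite lerDl sumr_ge0 // => h _; rewrite mulr_ge0 ?walk_weight_ge0 // ltW.
Qed.

Lemma walk_weight_closed g s : path r g s -> last g s = g ->
  \prod_(f <- s) a f <= walk_weight g (size s) g.
Proof.
move=> gs ls; have := walk_weight_path g 0 gs.
by rewrite ls /= eqxx mulr1 addn0.
Qed.

Lemma walk_weight_addr g n k e :
  walk_weight g n g * walk_weight g k e <= walk_weight g (k + n) e.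
Proof.
elim: k e => [|k IHk] e /=.
  by case: eqP => [->|_]; rewrite ?mulr1 // mulr0 walk_weight_ge0.
rewrite mulr_sumr; apply: ler_sum => f _.
by rewrite mulrCA ler_pM2l.
Qed.

Lemma sumr_gt0_exists (I : finType) (F : I -> R) i :
  (forall j, 0 <= F j) -> 0 < F i -> 0 < \sum_j F j.
Proof.
by move=> F0 Fi; rewrite (bigD1 i) //= ltr_pwDl // sumr_ge0.
Qed.

(** Take for [y e] the sum of [W (k + j) e] over [k < K] and [j < N]. The matrix shifts [j] by one,
    so the gain telescopes to the sum over [k] of [W (k + N) e - W k e], each term being at least
    [(W N g - 1) * W k e]. *)
Lemma strict_subsolution g N : (forall e, connect r e g) ->
  1 < walk_weight g N g ->
  exists y : E -> R, forall e, 0 < y e < \sum_(f | r e f) a f * y f.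
Proof.
move=> conn W1; pose W := walk_weight g.
have N0 : (0 < N)%N by case: (N) W1; rewrite /= ?eqxx ?ltxx.
(* [K] exceeds the length of some walk from each [e] to [g], which makes the gain positive. *)
have [K KP] : exists K, forall e, exists k : 'I_K, 0 < W k e.
  have kP e : exists k, 0 < W k e.
    have /connectP[p ep gE] := conn e; exists (size p).
    have := walk_weight_path g 0 ep; rewrite -gE /= eqxx mulr1 addn0.
    by apply: lt_le_trans; rewrite prodr_gt0.
  have [k {}kP] := choice kP.
  exists (\max_e k e).+1 => e.
  have ke : (k e < (\max_e k e).+1)%N := leq_bigmax (F := k) e.
  by exists (Ordinal ke); exact: kP.
have W0 n e : 0 <= W n e := walk_weight_ge0 g n e.
have WK e : 0 < \sum_(k < K) W k e.
  by have [k kW] := KP e; apply: (sumr_gt0_exists (i := k)).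
exists (fun e => \sum_(k < K) \sum_(j < N) W (k + j)%N e) => e.
apply/andP; split.
  have [k kW] := KP e; apply: (sumr_gt0_exists (i := k)) => [j|].
    exact: sumr_ge0.
  by apply: (sumr_gt0_exists (i := Ordinal N0)); rewrite //= addn0.
have -> : \sum_(f | r e f) a f * (\sum_(k < K) \sum_(j < N) W (k + j)%N f) =
    \sum_(k < K) \sum_(j < N) W (k + j).+1 e.
  under eq_bigr => f _ do rewrite mulr_sumr.
  rewrite exchange_big /=; apply: eq_bigr => k _.
  under eq_bigr => f _ do rewrite mulr_sumr.
  by rewrite exchange_big.
rewrite -subr_gt0 -sumrB.
apply: (@lt_le_trans _ _ ((W N g - 1) * \sum_(k < K) W k e)).
  by rewrite mulr_gt0 // subr_gt0.
rewrite mulr_sumr; apply: ler_sum => k _.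
suff -> : \sum_(j < N) W (k + j).+1 e - \sum_(j < N) W (k + j)%N e =
    W (k + N)%N e - W k e.
  by rewrite mulrBl mul1r lerD2r; exact: walk_weight_addr.
elim: (N) => [|n IHn]; first by rewrite !big_ord0 addn0 !subrr.
by rewrite !big_ord_recr /= addnS opprD addrACA IHn; ring.
Qed.

End WalkWeight.

Lemma finite_lower_bound (R : realFieldType) (I : finType) (F : I -> R) :
  (forall i, 0 < F i) -> exists2 d, 0 < d & forall i, d <= F i.
Proof.
move=> F0; pose S := \sum_i (F i)^-1.
have S0 : 0 <= S by apply: sumr_ge0 => i _; rewrite invr_ge0 ltW.
have S1 : 0 < 1 + S by rewrite ltr_pwDl.
exists (1 + S)^-1 => [|i]; first by rewrite invr_gt0.
rewrite -[F i]invrK lef_pV2 ?posrE ?invr_gt0 //.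
rewrite /S (bigD1 i) //= addrCA lerDl addr_ge0 // sumr_ge0 // => j _.
by rewrite invr_ge0 ltW.
Qed.

(** * Edge weights giving superharmonic functions *)

Section EdgeWeights.
Context {R : realType}.
Variable G : wmultigraph R.
Implicit Types (e f g : oedge G).
Hypotheses (A1 : irreducible_rw G) (A2 : two_cycles G)
  (A3 : positive_weights G) (A4 : edges_on_cycles G).

Let a e := weight e / weight (einv e).

Let a_gt0 e : 0 < a e.
Proof. by rewrite divr_gt0. Qed.

(* A closed walk and its reversal have inverse weights. Hence it suffices to
   find two distinct closed walks with the same weight and length from the same
   edge, and these are the two products of two closed walks which diverge. *)
Lemma walk_weight_gt1 : exists g N, 1 < walk_weight (@nbstep _ G) a g N g.
Proof.
have [g [g1 [g2 [gg1 gg2 g12]]]] := nbstep_diverge A1 A2 A3 A4.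
have /connectP[s1 s1P l1] := nbstep_connected A1 A2 A3 A4 g1 g.
have /connectP[s2 s2P l2] := nbstep_connected A1 A2 A3 A4 g2 g.
pose q := (g1 :: s1) ++ (g2 :: s2).
have gq : path (@nbstep _ G) g q.
  by rewrite cat_path /= gg1 s1P -l1 gg2 s2P.
have lq : last g q = g by rewrite last_cat /= -l2.
pose A := \prod_(f <- q) a f.
have A0 : 0 < A by apply: prodr_gt0.
(* The two closed walks in either order begin with [g1] and [g2], so they lie in separate terms of
   the sum over the first step, and the total is at least [2 * A]. *)
have [A1'|A1'] := leP 1 A.
  exists g, (size q); rewrite /= (bigD1 g1) //= (bigD1 g2) /=; last first.
    by rewrite gg2 eq_sym.
  set S := \sum_(f | _) _.
  have S0 : 0 <= S.
    by apply: sumr_ge0 => f _; rewrite mulr_ge0 ?walk_weight_ge0 // ltW.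
  pose W := walk_weight (@nbstep _ G) a g.
  have H1 : A <= a g1 * W (size (s1 ++ g2 :: s2)) g1.
    have p1 : path (@nbstep _ G) g1 (s1 ++ g2 :: s2).
      by rewrite cat_path /= s1P -l1 gg2.
    rewrite /A big_cons ler_pM2l // -[size _]addn0.
    apply: le_trans (walk_weight_path a_gt0 g 0 p1).
    by rewrite last_cat /= -l2 eqxx mulr1.
  have H2 : A <= a g2 * W (size (s1 ++ g2 :: s2)) g2.
    have p2 : path (@nbstep _ G) g2 (s2 ++ g1 :: s1).
      by rewrite cat_path /= s2P -l2 gg1.
    have -> : A = a g2 * \prod_(f <- s2 ++ g1 :: s1) a f.
      by rewrite /A /q !(big_cat, big_cons) /=; ring.
    rewrite ler_pM2l //.
    have -> : size (s1 ++ g2 :: s2) = (size (s2 ++ g1 :: s1) + 0)%N.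
      by rewrite !size_cat /=; lia.
    apply: le_trans (walk_weight_path a_gt0 g 0 p2).
    by rewrite last_cat /= -l1 eqxx mulr1.
  by rewrite /W /= in H1 H2; lra.
(* For [A < 1], the reversed walk has weight [A^-1]: as [q] ends with [g], [belast g q] has the same
   edges as [q]. *)
pose rq := map (@einv _ G) (rev (belast g q)).
have rqP : path (@nbstep _ G) (einv g) rq.
  rewrite -[in einv g]lq path_map -(eq_path (e := fun x y => nbstep y x)).
    by rewrite rev_path.
  by move=> e f /=; rewrite nbstep_einv.
have lrq : last (einv g) rq = einv g.
  by rewrite last_map /q /= rev_cons last_rcons.
exists (einv g), (size rq).
apply: lt_le_trans (walk_weight_closed a_gt0 rqP lrq).
have -> : \prod_(f <- rq) a f = A^-1.
  have pq : perm_eq (rev (belast g q)) q.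
    rewrite perm_rev -(perm_cons g).
    have -> : g :: belast g q = last g q :: belast g q by rewrite lq.
    by rewrite -perm_rcons -lastI.
  rewrite /A -prodfV big_map (perm_big q pq) /=.
  by apply: eq_bigr => f _; rewrite /a einvK invf_div.
by rewrite invf_gt1.
Qed.

Lemma superharmonic_edge_weights : exists (phi : oedge G -> R) (k : R),
  [/\ 0 < k < 1, forall e, 0 < phi e <= k &
    forall e, weight (einv e) + phi e * (\sum_(f | nbstep e f) weight f * phi f)
      <= phi e].
Proof.
have [g [N gN]] := walk_weight_gt1.
have [y yP] := strict_subsolution a_gt0
  ((nbstep_connected A1 A2 A3 A4)^~ g) gN.
(* In terms of [x], the inequality for [y] reads [weight (einv e) * x e < S e]. *)
pose x e := y e / weight (einv e).
have w0 e : weight e != 0 by rewrite gt_eqF.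
have x0 e : 0 < x e by case/andP: (yP e) => y0 _; rewrite divr_gt0.
pose S e := \sum_(f | nbstep e f) weight f * x f.
have xS e : weight (einv e) * x e < S e.
  case/andP: (yP e) => _; rewrite /x mulrCA divff // mulr1.
  congr (_ < _); apply: eq_bigr => f _; rewrite /a /x; ring.
have sw e : weight (einv e) + \sum_(f | nbstep e f) weight f = 1.
  rewrite -(weight_out (tgt e)) [RHS](bigD1 (einv e)) /= ?src_einv //.
  congr (_ + _); apply: eq_bigl => f; rewrite /nbstep eq_sym.
  by congr (_ && _); rewrite -(inj_eq (@einv_inj _ G)) einvK eq_sym.
clearbody x; have [d d0 dP] := finite_lower_bound x0.
(* With [phi = 1 - eps x], the condition reads [eps x S <= S - w x], where [w]
   is the weight of the inverse edge. *)
have F0 e : 0 < Num.min (2^-1 / x e)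
    ((S e - weight (einv e) * x e) / (x e * S e)).
  have S0 : 0 < S e by apply: le_lt_trans (xS e); rewrite mulr_ge0 // ltW.
  by rewrite lt_min !divr_gt0 ?subr_gt0 ?mulr_gt0 ?invr_gt0.
have [eps e0 eP] := finite_lower_bound F0.
have eps1 e : eps * x e <= 2^-1.
  by have := eP e; rewrite le_min ler_pdivlMr // => /andP[].
have eps2 e : eps * (x e * S e) <= S e - weight (einv e) * x e.
  have S0 : 0 < S e by apply: le_lt_trans (xS e); rewrite mulr_ge0 // ltW.
  by have := eP e; rewrite le_min => /andP[_]; rewrite ler_pdivlMr // mulr_gt0.
have ed e : eps * d <= eps * x e by rewrite ler_pM2l.
(* [1 - eps * d] is below 1 and bounds all weights because [d > 0] bounds [x] from below; [eps1]
   keeps the weights at least 1/2. *)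
exists (fun e => 1 - eps * x e), (1 - eps * d); split.
- have := ed g; have := eps1 g; have : 0 < eps * d by rewrite mulr_gt0.
  by move=> *; apply/andP; split; lra.
- by move=> e; have := ed e; have := eps1 e; move=> *; apply/andP; split; lra.
move=> e.
have -> : \sum_(f | nbstep e f) weight f * (1 - eps * x f) =
    1 - weight (einv e) - eps * S e.
  have -> : 1 - weight (einv e) = \sum_(f | nbstep e f) weight f.
    by rewrite -(sw e) addrAC subrr add0r.
  rewrite /S mulr_sumr -sumrB.
  by apply: eq_bigr => f _; ring.
have := eps2 e; move: (S e) (x e) (weight (einv e)) => s z w.
move=> H; have := ler_wpM2l (ltW e0) H; move=> K.
have -> : w + (1 - eps * z) * (1 - w - eps * s) =
  1 - eps * z + (eps * (eps * (z * s)) - eps * (s - w * z)) by ring.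
lra.
Qed.

End EdgeWeights.

(** * Hitting probabilities of Markov chains with finitely many successors per state *)

Section MarkovHitting.
Context {R : realType} {d : measure_display} {T : measurableType d}.
Variables (P : probability T R) (S : countType) (x0 : S) (p : S -> S -> R).
Variable X : nat -> T -> S.
Hypothesis chain : markov_chain_from P x0 p X.
Variable nbr : S -> seq S.
Hypothesis nbr_uniq : forall x, uniq (nbr x).
Hypothesis nbr_sum : forall x, \sum_(z <- nbr x) p x z = 1.

Lemma measurable_state n (A : set S) : measurable [set w | A (X n w)].
Proof.
have [mX _ _] := chain.
rewrite [X in measurable X](_ : _ =
    \bigcup_(x : S) ([set w | X n w = x] `&` [set _ | A x])); last first.
  apply/seteqP; split => [w Aw|w [x _ [<-]]] //=.
  by exists (X n w).
apply: countable_bigcupT_measurable => // x.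
apply: measurableI; first exact: mX.
have [Ax|nAx] := pselect (A x).
  by rewrite [X in measurable X](_ : _ = setT) //; apply/seteqP; split.
by rewrite [X in measurable X](_ : _ = set0) //; apply/seteqP; split.
Qed.

Definition history (s : nat) (x : nat -> S) : set T :=
  [set w | forall i, (i <= s)%N -> X i w = x i].

Lemma measurable_history s x : measurable (history s x).
Proof.
have [mX _ _] := chain.
rewrite [X in measurable X](_ : _ =
    \bigcap_(i in [set i | (i <= s)%N]) [set w | X i w = x i]).
  exact: bigcap_measurableType.
by [].
Qed.

Definition extend (x : nat -> S) (s : nat) (z : S) (i : nat) : S :=
  if (i <= s)%N then x i else z.

Lemma history_extend s x z :
  history s.+1 (extend x s z) = history s x `&` [set w | X s.+1 w = z].
Proof.
apply/seteqP; split => w /=.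
  move=> H; split=> [i lis|]; last by rewrite H // /extend ltnn.
  by rewrite H ?(leq_trans lis) // /extend lis.
move=> [H Hz] i; rewrite leq_eqVlt => /orP[/eqP ->|lis].
  by rewrite /extend ltnn.
by rewrite /extend -ltnS lis; exact: H.
Qed.

Lemma probability_history_extend s x z :
  (P (history s x `&` [set w | X s.+1 w = z]) =
   P (history s x) * (p (x s) z)%:E)%E.
Proof. by have [_ _ /(_ s x z)] := chain. Qed.

Lemma measure_seq_cover (A : set T) n (s : seq S) : measurable A -> uniq s ->
  (P (A `&` [set w | X n w \in s]) =
   \sum_(z <- s) P (A `&` [set w | X n w = z]))%E.
Proof.
have [mX _ _] := chain.
move=> mA; elim: s => [|z s IHs] /=.
  move=> _; rewrite big_nil (_ : _ `&` _ = set0) ?measure0 //.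
  by apply/seteqP; split => w //= [].
move=> /andP[zs us]; rewrite big_cons -IHs // -measureU.
- congr (P _); rewrite -setIUr; congr (_ `&` _).
  apply/seteqP; split => w /=; rewrite inE.
    by case/orP => [/eqP|]; [left|right].
  by case=> [->|->]; rewrite ?eqxx ?orbT.
- by apply: measurableI => //; exact: mX.
- by apply: measurableI => //; exact: (measurable_state n [set z | z \in s]).
- apply/seteqP; split => w //= [[_ Xz] [_]]; rewrite Xz => zs'.
  by move: zs; rewrite zs'.
Qed.

(** Conditioning on one step: the transition probabilities over [nbr (x s)] sum to 1, so the next
    state lies there almost surely on the history, and the bounds [b] are averaged. *)
Lemma history_step (E : set T) s x (b : S -> R) : measurable E ->
  (forall z, z \in nbr (x s) ->
    P (history s.+1 (extend x s z) `&` E)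
      <= (b z)%:E * P (history s.+1 (extend x s z)))%E ->
  (P (history s x `&` E)
    <= (\sum_(z <- nbr (x s)) p (x s) z * b z)%:E * P (history s x))%E.
Proof.
move=> mE H; have mH := measurable_history s x.
pose U := [set w | X s.+1 w \in nbr (x s)].
have mU : measurable U := measurable_state s.+1 [set z | z \in nbr (x s)].
have coverU A : measurable A -> (P (A `&` U) =
    \sum_(z <- nbr (x s)) P (A `&` [set w | X s.+1 w = z]))%E.
  by move=> mA; exact: measure_seq_cover.
have DI A : measurable A -> (P A = P (A `\` U) + P (A `&` U))%E.
  by move=> mA; exact: measureDI.
have PH : P (history s x) = (fine (P (history s x)))%:E.
  by rewrite fineK //; exact: fin_num_measure.
have HU0 : P (history s x `\` U) = 0%E.
  have mHU := measurableD mH mU; have := DI _ mH; rewrite coverU //.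
  under eq_bigr do rewrite probability_history_extend PH -EFinM.
  rewrite sumEFin -mulr_sumr nbr_sum mulr1 PH -(fineK (fin_num_measure P _ mHU)).
  by rewrite -EFinD => -[] H0; congr EFin; lra.
rewrite DI; last exact: measurableI.
have -> : P ((history s x `&` E) `\` U) = 0%E.
  apply/eqP; rewrite eq_le measure_ge0 andbT -HU0.
  apply: le_measure; rewrite ?inE; [..|by move=> w [[]]].
    by apply: measurableD => //; exact: measurableI.
  exact: measurableD.
rewrite add0e coverU; last exact: measurableI.
rewrite PH -EFinM mulr_suml -sumEFin.
rewrite big_seq [leRHS]big_seq; apply: lee_sum => z zn.
have := H z zn; rewrite history_extend setIAC => /le_trans; apply.
rewrite probability_history_extend PH -!EFinM lee_fin.
by rewrite mulrCA mulrC [b z * _]mulrC.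
Qed.

Section Superharmonic.
Variables (h : S -> R) (B : pred S).
Hypothesis h_ge0 : forall z, 0 <= h z.
Hypothesis h_B : forall z, B z -> 1 <= h z.
Hypothesis h_super : forall x, \sum_(z <- nbr x) p x z * h z <= h x.

Definition hits s n : set T :=
  [set w | exists t', (s <= t' <= s + n)%N /\ B (X t' w)].

Lemma measurable_hits s n : measurable (hits s n).
Proof.
rewrite [X in measurable X](_ : _ =
    \bigcup_(t in [set t | (s <= t <= s + n)%N]) [set w | B (X t w)]).
  by apply: bigcup_measurable => t _; exact: (measurable_state t [set z | B z]).
by apply/seteqP; split => [w [t' [? ?]]|w [t' ? ?]]; exists t'.
Qed.

(** Optional stopping, by induction on the horizon: in [B] the bound holds as [h] is at least 1;
    outside [B] a hit must come from time [s.+1] on, and [h_super] averages the bounds after one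
    step. *)
Lemma history_hits n s x :
  (P (history s x `&` hits s n) <= (h (x s))%:E * P (history s x))%E.
Proof.
have le_hist m u y : B (y u) ->
    (P (history u y `&` hits u m) <= (h (y u))%:E * P (history u y))%E.
  move=> By; apply: (@le_trans _ _ (P (history u y))).
    apply: le_measure; rewrite ?inE; last by move=> w [].
      by apply: measurableI; [exact: measurable_history|exact: measurable_hits].
    exact: measurable_history.
  by rewrite -[leLHS]mul1e lee_wpmul2r // lee_fin h_B.
elim: n s x => [|n IHn] s x; have [Bx|nBx] := boolP (B (x s)).
- exact: le_hist.
- rewrite (_ : _ `&` _ = set0) ?measure0 ?mule_ge0 ?lee_fin //.
  apply/seteqP; split => w //= [Hw [t' []]]; rewrite addn0 -eqn_leq => /eqP <-.
  by rewrite Hw // (negbTE nBx).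
- exact: le_hist.
- rewrite (_ : _ `&` _ = history s x `&` hits s.+1 n); last first.
    apply/seteqP; split => w /= [Hw [t' [st' Bt']]]; split=> //; exists t'.
      split=> //; rewrite addSnnS; case/andP: st' => st' ->; rewrite andbT.
      rewrite ltn_neqAle st' andbT; apply/eqP => st.
      by move: Bt'; rewrite -st Hw // (negbTE nBx).
    by split=> //; move: st'; rewrite addSnnS => /andP[/ltnW -> ->].
  apply: (le_trans (history_step (b := h) (measurable_hits _ _) _)).
    move=> z _; have := IHn s.+1 (extend x s z).
    by rewrite (_ : extend x s z s.+1 = z) // /extend ltnn.
  by rewrite lee_wpmul2r // lee_fin.
Qed.

Definition ever_hits s : set T := [set w | exists t', (s <= t')%N /\ B (X t' w)].

Lemma ever_hitsE s : ever_hits s = \bigcup_n hits s n.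
Proof.
apply/seteqP; split => [w [t' [st' Bt']]|w [n _ [t' [/andP[st' _] Bt']]]].
  by exists t' => //; exists t'; rewrite st' leq_addl.
by exists t'.
Qed.

Lemma measurable_ever_hits s : measurable (ever_hits s).
Proof.
rewrite ever_hitsE; apply: bigcup_measurable => n _; exact: measurable_hits.
Qed.

(** The events [hits s n] increase to [ever_hits s], with a bound independent of [n]. *)
Lemma history_ever_hits s x :
  (P (history s x `&` ever_hits s) <= (h (x s))%:E * P (history s x))%E.
Proof.
rewrite ever_hitsE setI_bigcupr.
have mF n : measurable (history s x `&` hits s n).
  by apply: measurableI; [exact: measurable_history | exact: measurable_hits].
have F_homo : {homo (fun n => history s x `&` hits s n) :
    m n / (m <= n)%N >-> (m <= n)%O}.
  move=> m n mn; apply/subsetPset => w [Hw [t' [/andP[st' t'm] Bt']]].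
  split=> //; exists t'; rewrite st' (leq_trans t'm) //.
  by rewrite leq_add2l.
have F_cvg := nondecreasing_cvg_mu (mu := P) mF (bigcupT_measurable _ mF) F_homo.
rewrite -(cvg_lim _ F_cvg) //; apply: lime_le.
  by apply/cvg_ex; eexists; exact: F_cvg.
by apply: nearW => n; exact: history_hits.
Qed.

End Superharmonic.

(** Total probability over histories, by backward induction from time [t] to time 0: [history_step]
    with constant [b] removes one step at a time. *)
Lemma probability_le_history (E : set T) (C : R) t : measurable E ->
  (forall x, x 0%N = x0 ->
    P (history t x `&` E) <= C%:E * P (history t x))%E ->
  (P E <= C%:E)%E.
Proof.
move=> mE H; have [_ P0 _] := chain.
have {}H s x : (s <= t)%N -> x 0%N = x0 ->
    (P (history s x `&` E) <= C%:E * P (history s x))%E.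
  move=> st; rewrite -(subKn st); move: (t - s)%N (leq_subr s t) x => k.
  elim: k => [|k IHk] kt x x00; first by rewrite subn0; exact: H.
  have kS : (t - k = (t - k.+1).+1)%N by lia.
  have := history_step (s := t - k.+1) (x := x) (b := fun=> C) mE.
  rewrite -mulr_suml nbr_sum mul1r; apply => z _.
  by rewrite -kS; apply: IHk; [exact: ltnW|].
have := H 0%N (fun=> x0) (leq0n _) erefl.
have hE : history 0 (fun=> x0) = [set w | X 0%N w = x0].
  apply/seteqP; split => w /=; first by apply.
  by move=> Hw i; rewrite leqn0 => /eqP ->.
have mh : measurable (history 0 (fun=> x0)) := measurable_history _ _.
have Ph : P (history 0 (fun=> x0)) = 1%E by rewrite hE.
rewrite Ph mule1; apply: le_trans.
rewrite (measureDI P mE mh) setIC -[leRHS]add0e leeD2r //.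
rewrite -(_ : P (~` history 0 (fun=> x0)) = 0%E).
  apply: le_measure; rewrite ?inE; [exact: measurableD|exact: measurableC|].
  by move=> w [].
by rewrite probability_setC // Ph subee.
Qed.

Lemma history_trans_neq0 s x : P (history s x) != 0%E ->
  forall i, (i < s)%N -> p (x i) (x i.+1) != 0.
Proof.
move=> + i si; apply: contra_neq => pi0.
have [_ _ /(_ i x (x i.+1))] := chain; rewrite pi0 mule0 => P0.
apply/eqP; rewrite eq_le measure_ge0 andbT -P0.
have -> : [set w | (forall j, (j <= i)%N -> X j w = x j) /\ X i.+1 w = x i.+1]
    = history i x `&` [set w | X i.+1 w = x i.+1] by [].
apply: le_measure; rewrite ?inE; first exact: measurable_history.
  apply: measurableI; first exact: measurable_history.
  exact: (measurable_state i.+1 [set x i.+1]).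
move=> w Hw; split=> [j ji|]; apply: Hw => //.
by apply: leq_trans ji _; exact: ltnW.
Qed.

End MarkovHitting.

(** * Geometry of the universal cover, and path weights *)

Section CoverGeometry.
Context {R : realType} {G : wmultigraph R} {v : vertex G}.
Implicit Types (e f : oedge G) (p q : seq (oedge G)) (x y z : ucover v).

Lemma nbpath_rcons2 q f e :
  nbpath v (rcons (rcons q f) e) = nbpath v (rcons q f) && nbstep f e.
Proof.
case: q => [|g q] /=; first by rewrite !andbT.
by rewrite !rcons_path last_rcons andbA.
Qed.

Lemma nbpath_rcons p e :
  nbpath v (rcons p e) -> nbpath v p /\ src e = last v (map (@tgt _ G) p).
Proof.
case/lastP: p => [|q f]; first by rewrite /= andbT => /eqP.
rewrite nbpath_rcons2 map_rcons last_rcons => /andP[-> /andP[/eqP -> _]].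
by [].
Qed.

Lemma nbpath_take p k : nbpath v p -> nbpath v (take k p).
Proof. by case: p k => [|e p] [|k] //= /andP[-> pp]; exact: take_path. Qed.

(** The covering map to the base graph; the root goes to [v]. *)
Definition endpoint x : vertex G := last v (map (@tgt _ G) (val x)).

(** Multiplication by [e] on reduced words: a last edge equal to [einv e] cancels. *)
Definition extend_path p e : seq (oedge G) :=
  if p is f :: p' then
    if last f p' == einv e then belast f p' else rcons p e
  else [:: e].

Lemma extend_path_rcons q f e :
  extend_path (rcons q f) e = if f == einv e then q else rcons (rcons q f) e.
Proof.
by case: q => [|g q] //=; rewrite last_rcons belast_rcons.
Qed.

Definition cover_step x e : ucover v := insubd x (extend_path (val x) e).

Lemma val_cover_step x e : src e = endpoint x ->
  val (cover_step x e) = extend_path (val x) e.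
Proof.
rewrite /endpoint => xe; rewrite insubdK //; case: x xe => p /= np.
case/lastP: p np => [|q f] np; first by rewrite /in_mem /= => ->; rewrite eqxx.
rewrite map_rcons last_rcons extend_path_rcons /in_mem /= => ef.
case: eqVneq => [_|fe]; first by have [] := nbpath_rcons np.
by rewrite nbpath_rcons2 np nbstepP.
Qed.

(** The covering property: arrows out of [x] correspond to edges of the base graph out of
    [endpoint x]. *)
Lemma cover_arrowE x e z :
  cover_arrow x e z = (src e == endpoint x) && (z == cover_step x e).
Proof.
apply/idP/andP => [|[/eqP xe /eqP ->]]; last first.
  rewrite /cover_arrow val_cover_step //; case/lastP: (val x) => [|q f] //=.
    by rewrite eqxx.
  rewrite extend_path_rcons.
  by case: (eqVneq f (einv e)) => [->|_] /=; rewrite eqxx ?orbT.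
have nz := valP z; have nx := valP x.
case/orP => /eqP xz.
  rewrite xz in nz; have [_ xe] := nbpath_rcons nz.
  split; first exact/eqP.
  apply/eqP/val_inj; rewrite val_cover_step // xz.
  case/lastP: (val x) nz => [|q f] //; rewrite nbpath_rcons2 extend_path_rcons.
  by case/andP => _ /andP[_ /negbTE ->].
have xe : src e = endpoint x.
  by rewrite /endpoint xz map_rcons last_rcons tgt_einv.
split; first exact/eqP.
by apply/eqP/val_inj; rewrite val_cover_step // xz extend_path_rcons eqxx.
Qed.

Definition neighbours x : seq (ucover v) :=
  undup (x :: [seq cover_step x e | e <- enum (oedge G) & src e == endpoint x]).

Lemma sum_delta (I : eqType) (r : seq I) (i : I) (F : I -> R) :
  i \in r -> uniq r -> \sum_(j <- r) (j == i)%:R * F j = F i.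
Proof.
move=> ir ur; rewrite (bigD1_seq i) //= eqxx mul1r big1 ?addr0 // => j ji.
by rewrite (negbTE ji) mul0r.
Qed.

Lemma cover_trans_sum x (g : ucover v -> R) :
  \sum_(z <- neighbours x) cover_trans x z * g z =
  2^-1 * g x +
    2^-1 * \sum_(e | src e == endpoint x) weight e * g (cover_step x e).
Proof.
have un : uniq (neighbours x) by exact: undup_uniq.
(* Each transition probability is a sum of Kronecker deltas, so the sum over [z] collapses term by
   term. *)
transitivity (\sum_(z <- neighbours x) (z == x)%:R * (2^-1 * g z) +
    \sum_(e | src e == endpoint x) \sum_(z <- neighbours x)
      (z == cover_step x e)%:R * (2^-1 * weight e * g z)).
  rewrite exchange_big /= -big_split; apply: eq_bigr => z _ /=.
  rewrite /cover_trans /rw_trans mulrDl eq_sym; congr (_ + _); first by ring.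
  rewrite mulrAC mulr_sumr.
  rewrite big_mkcond [RHS]big_mkcond; apply: eq_bigr => e _.
  rewrite cover_arrowE; case: (src e == endpoint x) => //=.
  by case: (z == _); rewrite /= ?mul0r // mul1r; ring.
rewrite sum_delta ?mem_undup ?mem_head //; congr (_ + _).
rewrite mulr_sumr; apply: eq_bigr => e xe; rewrite sum_delta //.
  by rewrite mulrA.
by rewrite mem_undup inE map_f ?orbT // mem_filter xe mem_enum.
Qed.

Lemma sum_cover_trans x : \sum_(z <- neighbours x) cover_trans x z = 1.
Proof.
have := cover_trans_sum x (fun=> 1); under eq_bigr do rewrite mulr1.
move=> ->; under eq_bigr do rewrite mulr1.
by rewrite weight_out; lra.
Qed.

Section PathWeight.
Variables (phi : oedge G -> R) (k : R).
Hypothesis phi_gt0 : forall e, 0 < phi e.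
Hypothesis phi_le : forall e, phi e <= k.
Hypothesis k_lt1 : k < 1.
Hypothesis phi_super : forall e,
  weight (einv e) + phi e * (\sum_(f | nbstep e f) weight f * phi f) <= phi e.

Definition path_weight y z : R :=
  if prefix (val y) (val z)
  then \prod_(e <- drop (size (val y)) (val z)) phi e else 1.

Lemma path_weight_ge0 y z : 0 <= path_weight y z.
Proof.
by rewrite /path_weight; case: ifP => // _; apply: prodr_ge0 => e _; exact: ltW.
Qed.

Lemma path_weight_le1 y z : path_weight y z <= 1.
Proof.
rewrite /path_weight; case: ifP => // _; apply: prodr_ile1 => e _.
by rewrite ltW //= (le_trans (phi_le e)) // ltW.
Qed.

Lemma prod_phi_le q : \prod_(e <- q) phi e <= k ^+ size q.
Proof.
elim: q => [|e q IHq] /=; first by rewrite big_nil.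
rewrite big_cons exprS ler_pM //; first exact: ltW.
by apply: prodr_ge0 => f _; exact: ltW.
Qed.

(** Laziness cancels. Where the weight at [x] is 1, it suffices that weights are at most 1. Strictly
    below [y], with [f] the last edge to [x], the product over the earlier edges factors out and
    leaves [phi_super f]. *)
Lemma path_weight_superharmonic y x :
  \sum_(z <- neighbours x) cover_trans x z * path_weight y z <= path_weight y x.
Proof.
rewrite cover_trans_sum.
suff : \sum_(e | src e == endpoint x) weight e * path_weight y (cover_step x e)
    <= path_weight y x by lra.
have le1 : \sum_(e | src e == endpoint x)
    weight e * path_weight y (cover_step x e) <= 1.
  rewrite -(weight_out (endpoint x)); apply: ler_sum => e _.
  by rewrite ler_piMr ?path_weight_le1 // weight_ge0.
rewrite {2}/path_weight; case: ifP => // /prefixP[s xE].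
rewrite xE drop_size_cat //; case/lastP: s xE => [|q f] xE.
  by rewrite big_nil.
have endx : endpoint x = tgt f.
  by rewrite /endpoint xE map_cat last_cat map_rcons last_rcons.
rewrite (bigD1 (einv f)) /= ?src_einv ?endx //.
have -> : path_weight y (cover_step x (einv f)) = \prod_(e <- q) phi e.
  rewrite /path_weight val_cover_step ?src_einv ?endx // xE -rcons_cat.
  rewrite extend_path_rcons einvK eqxx drop_size_cat //.
  by rewrite prefix_catl // prefix_refl.
rewrite big_rcons /= mulrC.
have -> : \sum_(e | (src e == tgt f) && (e != einv f))
      weight e * path_weight y (cover_step x e) =
    (\prod_(e <- q) phi e) *
      (phi f * \sum_(e | nbstep f e) weight e * phi e).
  rewrite mulrA mulr_sumr; apply: eq_big => [e|e /andP[/eqP se ef]].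
    rewrite /nbstep eq_sym; congr (_ && _).
    by rewrite -(inj_eq (@einv_inj _ G)) einvK eq_sym.
  rewrite /path_weight val_cover_step ?endx // xE -rcons_cat.
  rewrite extend_path_rcons rcons_cat.
  have -> : (f == einv e) = false.
    by apply/negbTE; apply: contra ef => /eqP ->; rewrite einvK.
  rewrite -cats1 -catA prefix_catl ?prefix_refl // drop_size_cat //.
  by rewrite cats1 !big_rcons /=; ring.
rewrite -mulrDr ler_wpM2l ?phi_super //.
by apply: prodr_ge0 => e _; exact: ltW.
Qed.

End PathWeight.

(** [k] is the depth from the root, so the [r]-th ancestor has [k = size (val z) - r]. *)
Definition ancestor z (k : nat) : ucover v := insubd z (take k (val z)).

Lemma val_ancestor z k : val (ancestor z k) = take k (val z).
Proof. by rewrite insubdK //; apply: nbpath_take; exact: valP. Qed.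

Lemma ancestor0 z : ancestor z 0 = cover_root.
Proof. by apply: val_inj; rewrite val_ancestor take0. Qed.

Lemma ancestor_size z : ancestor z (size (val z)) = z.
Proof. by apply: val_inj; rewrite val_ancestor take_size. Qed.

Lemma ancestor_arrow z k : (k < size (val z))%N ->
  exists e, cover_arrow (ancestor z k) e (ancestor z k.+1).
Proof.
move=> kz; have [e0 _] : exists e0 : oedge G, true.
  by case: (val z) kz => // e0 *; exists e0.
by exists (nth e0 (val z) k); rewrite /cover_arrow !val_ancestor -take_nth ?eqxx.
Qed.

Lemma ancestor_arrowV z k : (k < size (val z))%N ->
  exists e, cover_arrow (ancestor z k.+1) e (ancestor z k).
Proof.
move=> /ancestor_arrow[e ae]; exists (einv e).
by move: ae; rewrite /cover_arrow einvK orbC.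
Qed.

(** The successive ancestors of [z] form the simple path from the root, and [y] is one of them. *)
Lemma prefix_subtree y z : prefix (val y) (val z) -> subtree y z.
Proof.
move=> yz; have yE : y = ancestor z (size (val y)).
  by apply: val_inj; rewrite val_ancestor; move: yz; rewrite prefixE => /eqP.
have sE : cover_root :: [seq ancestor z j | j <- iota 1 (size (val z))] =
    [seq ancestor z j | j <- iota 0 (size (val z)).+1].
  by rewrite /= ancestor0.
exists [seq ancestor z j | j <- iota 1 (size (val z))]; split.
- suff gen m k : (k + m <= size (val z))%N ->
      path cover_adj (ancestor z k) [seq ancestor z j | j <- iota k.+1 m].
    by rewrite -(ancestor0 z); exact: gen.
  elim: m k => //= m IHm k kz.
  apply/andP; split; last by apply: IHm; rewrite addSnnS.
  have [|e ae] := @ancestor_arrow z k; last by apply/existsP; exists e.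
  by apply: leq_trans kz; rewrite addnS ltnS leq_addr.
- rewrite sE map_inj_in_uniq ?iota_uniq // => i j.
  rewrite !mem_iota !add0n !ltnS /= => iz jz /(congr1 (fun a => size (val a))).
  by rewrite !val_ancestor !size_takel.
- rewrite -(ancestor0 z) last_map -[RHS]ancestor_size; congr (ancestor z _).
  by case: (size _) => // n; rewrite -nth_last size_iota nth_iota.
- rewrite sE yE map_f // mem_iota /= add0n ltnS.
  by case/prefixP: yz => s ->; rewrite size_cat leq_addr.
Qed.

Lemma ancestor_ball (A3 : positive_weights G) z r : (r <= size (val z))%N ->
  cover_ball z r (ancestor z (size (val z) - r)).
Proof.
suff gen n : (r <= n <= size (val z))%N ->
    cover_ball (ancestor z n) r (ancestor z (n - r)).
  by move=> rz; rewrite -{1}(ancestor_size z); apply: gen; rewrite rz leqnn.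
elim: r n => [|r IHr] n; first by exists [::]; rewrite subn0.
case: n => // n; rewrite ltnS subSS => /andP[rn nz].
have [|s [ps ls ss]] := IHr n; first by rewrite rn ltnW.
exists (ancestor z n :: s); split=> //=; rewrite ps andbT.
have [e ae] := ancestor_arrowV nz.
by apply/existsP; exists e; rewrite ae A3.
Qed.

(** A step adds or removes one last edge, so a prefix gained in a step is the whole new path. *)
Lemma enter_subtree a b y : cover_trans a b != 0 ->
  ~~ prefix (val y) (val a) -> prefix (val y) (val b) -> b = y.
Proof.
move=> ab na pb; have neab : a != b by apply: contraNneq na => ->.
have [e /orP[/eqP bE|/eqP aE]] : exists e, cover_arrow a e b.
  apply: contrapT => nex; move/eqP: ab; apply.
  rewrite /cover_trans /rw_trans (negbTE neab) mulr0 add0r big_pred0 ?mulr0 //.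
  by move=> e; apply/negP => abe; apply: nex; exists e.
  apply: val_inj; move: pb na; rewrite bE => /prefixP[s].
  case/lastP: s => [|s f]; first by rewrite cats0.
  rewrite -rcons_cat => /rcons_inj[aE _] /negP[].
  by rewrite [val a]aE prefix_catl // prefix_refl.
by move: na; rewrite aE -cats1 prefix_catl.
Qed.

(** [s] is the last entrance into the subtree of [y]; it exists because the root lies outside, and
    it happens at [y] by [enter_subtree]. *)
Lemma last_entrance (x : nat -> ucover v) y t : x 0%N = cover_root ->
  y != cover_root -> (forall i, (i < t)%N -> cover_trans (x i) (x i.+1) != 0) ->
  prefix (val y) (val (x t)) ->
  exists s, [/\ (s <= t)%N, x s = y &
    forall i, (s <= i <= t)%N -> prefix (val y) (val (x i))].
Proof.
move=> x0 y0; elim: t => [|t IHt] xt yt.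
  move: yt; rewrite x0 prefixE /= => /eqP yE; case/eqP: y0.
  by apply: val_inj; rewrite /= -yE.
have [yxt|nyxt] := boolP (prefix (val y) (val (x t))).
  have [|s [st xs sP]] := IHt _ yxt; first by move=> i it; apply: xt; exact: ltnW.
  exists s; split=> //; first exact: leqW.
  move=> i /andP[si]; rewrite leq_eqVlt => /orP[/eqP -> //|it].
  by apply: sP; rewrite si.
exists t.+1; split=> //; first exact: enter_subtree (xt t (ltnSn t)) nyxt yt.
by move=> i; rewrite -eqn_leq => /eqP <-.
Qed.

End CoverGeometry.

(** * Avoiding the ray near the current position *)

Section RayEscape.
Context {R : realType} {G : wmultigraph R} {v : vertex G}.
Context {d : measure_display} {T : measurableType d}.
Variables (P : probability T R) (X : nat -> T -> ucover v).
Hypothesis chain : markov_chain_from P cover_root cover_trans X.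

Lemma measurable_ray_cover_ball r t :
  measurable [set w | ray (X ^~ w) `&` cover_ball (X t w) r = set0].
Proof.
have mS := measurable_state chain.
rewrite [Y in measurable Y](_ : _ = ~` \bigcup_(x : ucover v)
    ((\bigcup_s ([set w | X s w = x] `&`
       \bigcap_(u in [set u | (s <= u)%N]) [set w | subtree x (X u w)])) `&`
     [set w | cover_ball (X t w) r x])); last first.
  apply/seteqP; split => w /=.
    move=> /seteqP[sub _] [x _ [[s _ [Xs Hs]] xb]].
    by apply: (sub x); split=> //; exists s.
  move=> nex; apply/seteqP; split=> // x [[s [Xs Hs]] xb].
  by apply: nex; exists x => //; split=> //; exists s.
apply: measurableC; apply: countable_bigcupT_measurable; [exact: countableP|move=> x].
apply: measurableI; last exact: (mS t [set z | cover_ball z r x]).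
apply: bigcupT_measurable => s; apply: measurableI.
  exact: (mS s [set x]).
by apply: bigcap_measurableType => u _; exact: (mS u (subtree x)).
Qed.

(* The walk has visited the ancestor of its position at height [r] above it, and
   has not left its subtree between that visit and time [t]. *)
Lemma ray_cover_ball_hits (A3 : positive_weights G) r t (x : nat -> ucover v) w :
  x 0%N = cover_root ->
  (forall i, (i < t)%N -> cover_trans (x i) (x i.+1) != 0) ->
  history X t x w -> ray (X ^~ w) `&` cover_ball (X t w) r = set0 ->
  let y := ancestor (x t) (size (val (x t)) - r) in
  (r < size (val (x t)))%N /\
  ever_hits X (fun z => ~~ prefix (val y) (val z)) t w.
Proof.
move=> x0 xt Hw /seteqP[sub _] y; have Xt : X t w = x t by exact: Hw.
have ballP s : (s <= r)%N -> (s <= size (val (x t)))%N ->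
    cover_ball (X t w) r (ancestor (x t) (size (val (x t)) - s)).
  move=> sr sx; have [q [? ? qs]] := ancestor_ball A3 sx; rewrite Xt.
  by exists q; split=> //; exact: leq_trans sr.
(* At depth at most [r], the ball contains the root, which is always on the ray. *)
have [xr|xr] := leqP (size (val (x t))) r.
  case: (sub cover_root); split.
    exists 0%N; split; first by rewrite Hw.
    by move=> s _; apply: prefix_subtree; exact: prefix0s.
  by have := ballP _ xr (leqnn _); rewrite subnn ancestor0.
(* If the walk stayed in the subtree of [y] from time [t] on, [y] would be on the ray, as seen from
   its last entrance [s]. *)
split=> //; apply: contrapT => nhit.
have sub_t s : (t <= s)%N -> prefix (val y) (val (X s w)).
  by move=> ts; apply: contrapT => /negP ?; apply: nhit; exists s.
have y0 : y != cover_root.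
  rewrite -(inj_eq val_inj) val_ancestor -size_eq0 size_takel ?leq_subr //.
  by rewrite -lt0n subn_gt0.
have yxt : prefix (val y) (val (x t)) by rewrite -Xt sub_t.
have [s [st xs sP]] := last_entrance x0 y0 xt yxt.
apply: (sub y); split; last by apply: ballP => //; exact: ltnW.
exists s; split; first by rewrite Hw.
move=> u su; apply: prefix_subtree; have [ut|tu] := leqP u t.
  by rewrite Hw // sP // su.
by apply: sub_t; exact: ltnW.
Qed.

End RayEscape.

Theorem proposition4 (R : realType) (G : wmultigraph R)
    (A1 : irreducible_rw G) (A2 : two_cycles G)
    (A3 : positive_weights G) (A4 : edges_on_cycles G) :
  exists C1 C2 : R, 0 < C1 /\ 0 < C2 /\
    forall (v : vertex G) (d : measure_display) (T : measurableType d)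
      (P : probability T R) (X : nat -> T -> ucover v),
      markov_chain_from P cover_root cover_trans X ->
      forall r t : nat, (1 <= r)%N -> (1 <= t)%N ->
        (P [set w | ray (X ^~ w) `&` cover_ball (X t w) r = set0]
           <= (C1 * expR (- C2 * r%:R))%:E)%E.
Proof.
have [phi [k [/andP[k0 k1] phiP phi_super]]] :=
  superharmonic_edge_weights A1 A2 A3 A4.
have phi0 e : 0 < phi e by case/andP: (phiP e).
have phik e : phi e <= k by case/andP: (phiP e).
(* With these constants the bound is [k ^+ r]. *)
exists 1, (- ln k); split=> //; split; first by rewrite oppr_gt0 ln_lt0 // k0.
move=> v d T P X chain r t _ _.
rewrite mul1r opprK expRM_natr lnK ?posrE //.
have nb_uniq (x : ucover v) : uniq (neighbours x) by exact: undup_uniq.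
have mE := measurable_ray_cover_ball chain r t.
apply: (probability_le_history chain nb_uniq (@sum_cover_trans _ _ _) (t := t) mE).
move=> x x0; set E := [set w | _].
have mH := measurable_history chain t x.
have [PH0|PH0] := eqVneq (P (history X t x)) 0%E.
  rewrite PH0 mule0 -PH0; apply: le_measure; rewrite ?inE //.
  exact: measurableI.
have xt := history_trans_neq0 chain PH0.
have [xr|xr] := leqP (size (val (x t))) r.
  rewrite (_ : _ `&` _ = set0) ?measure0 ?mule_ge0 ?lee_fin ?exprn_ge0 // ?ltW //.
  apply/seteqP; split=> // w [Hw Ew].
  have [] := ray_cover_ball_hits A3 x0 xt Hw Ew.
  by rewrite ltnNge xr.
(* Given the history, [y] is a fixed vertex, and its path weight bounds the probability of leaving
   its subtree after time [t]. *)
pose y := ancestor (x t) (size (val (x t)) - r).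
pose B (z : ucover v) := ~~ prefix (val y) (val z).
have hB z : B z -> 1 <= path_weight phi y z.
  by rewrite /B /path_weight => /negbTE ->.
have mHit := measurable_ever_hits chain B t.
apply: (@le_trans _ _ (P (history X t x `&` ever_hits X B t))).
  apply: le_measure; rewrite ?inE; [exact: measurableI|exact: measurableI|].
  move=> w [Hw Ew]; split=> //.
  by have [] := ray_cover_ball_hits A3 x0 xt Hw Ew.
apply: le_trans (history_ever_hits chain nb_uniq (@sum_cover_trans _ _ _)
  (path_weight_ge0 phi0 y) hB
  (path_weight_superharmonic phi0 phik k1 phi_super y) t x) _.
(* The path from [y] to [x t] has [r] edges, each of weight at most [k]. *)
rewrite lee_wpmul2r // lee_fin.
rewrite /path_weight val_ancestor prefix_take.
apply: (le_trans (prod_phi_le phi0 phik _)).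
by rewrite size_takel ?leq_subr // size_drop subKn // ltnW.
Qed.
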